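(* Let $s\geq 4$ be an even integer and let $t\geq 3$ be an integer with $t \not\equiv 2, 4, 6, \dots, s-2 \pmod{s}$. Then for every integer $n\geq 0$, \[ C_{s}^{t}(n)=E_{s}^{t}(n). \]
   Context: $C_s^t(n)$ is the number of partitions of $n$ into parts not congruent to $2,4,\dots,s-2$ modulo $s$, in which each part appears fewer than $t$ times. $E_{s}^{t}(n)$ is the number of partitions of $n$ into parts that are not congruent to any of $2,4,\dots,s-2$ modulo $s$ and not congruent to any of $0$ and $t(2r+1)$, $r=0,1,\dots,s/2-1$, modulo $ts$. *)

(* Defs.v *)
From mathcomp Require Import all_boot.

Set Implicit Arguments.
Unset Strict Implicit.
Unset Printing Implicit Defensive.

Definition is_partition (n : nat) (p : seq nat) : bool :=
  [&& sorted geq p, all (leq 1) p & sumn p == n].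

(* A partition of n has at most n parts, each at most n (is_partition_bseq),
   so the carrier n.-bseq 'I_n.+1 contains all of them. *)
Definition num_partitions (n : nat) (P : pred (seq nat)) : nat :=
  #|[set p : n.-bseq 'I_n.+1 |
      is_partition n (map val p) && P (map val p)]|.

(* Meant for even s: the excluded residues are 2, 4, ..., s - 2. *)
Definition avoids_even (s m : nat) : bool :=
  all (fun j => m != 2 * j %[mod s]) (iota 1 (s./2 - 1)).

Definition avoids_t_multiples (s t m : nat) : bool :=
  (m != 0 %[mod t * s])
  && all (fun r => m != t * (2 * r + 1) %[mod t * s]) (iota 0 s./2).

Definition C (s t n : nat) : nat :=
  num_partitions n (fun p =>
    all (avoids_even s) p && all (fun x => count_mem x p < t) p).

Definition E (s t n : nat) : nat :=
  num_partitions n (fun p =>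
    all (avoids_even s) p && all (avoids_t_multiples s t) p).

Lemma is_partition_bseq (n : nat) (p : seq nat) :
  is_partition n p -> exists q : n.-bseq 'I_n.+1, map val q = p.
Proof.
case/and3P=> _ pos /eqP def_n.
have szp : size p <= n.
  rewrite -{}def_n; elim: p pos => //= x p IHp /andP[x_gt0 /IHp].
  by rewrite -add1n; apply: leq_add.
have lep : all (fun x => x < n.+1) p.
  apply/allP=> x xp; rewrite ltnS -def_n; elim: p xp {pos def_n szp} => //= y p IHp.
  rewrite inE => /predU1P[-> | /IHp le_xp]; first exact: leq_addr.
  exact: leq_trans le_xp (leq_addl _ _).
have szq : size (map (@inord n) p) <= n by rewrite size_map.
exists (Bseq szq) => /=; rewrite -map_comp -[RHS]map_id.
by apply/eq_in_map=> x /(allP lep) /inordK.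
Qed.

(* Main.v *)
Require Import Defs.
From mathcomp Require Import all_boot all_algebra.
From mathcomp Require Import zify.

(** Let A be the set of positive integers that are odd or divisible by s.  The
    parts allowed in [C] are the elements of A, and those allowed in [E] are the
    elements of A outside tA.  The condition on t says t \in A, which gives
    tA \subset A.  Both generating functions then become the product of
    (1 - X^(t a)) over a in A after multiplication by the product of (1 - X^a)
    over a in A.  All this is done with polynomials modulo X^(n+1), and the last
    product, having constant coefficient 1, can be cancelled. *)

Set Implicit Arguments.
Unset Strict Implicit.
Unset Printing Implicit Defensive.

Import GRing.Theory Num.Theory.
Local Open Scope ring_scope.

(** * Polynomials up to degree n *)

Section TruncatedCongruence.

Variables (R : comNzRingType) (n : nat).
Implicit Types p q r : {poly R}.

Definition eq_upto p q : Prop := forall i, (i <= n)%N -> p`_i = q`_i.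

Lemma eq_upto_sym p q : eq_upto p q -> eq_upto q p.
Proof. by move=> pq i /pq. Qed.

Lemma eq_upto_trans p q r : eq_upto p q -> eq_upto q r -> eq_upto p r.
Proof. by move=> pq qr i le_in; rewrite pq // qr. Qed.

Lemma eq_uptoM p p' q q' :
  eq_upto p p' -> eq_upto q q' -> eq_upto (p * q) (p' * q').
Proof.
move=> pp qq i le_in; rewrite !coefM; apply: eq_bigr => j _.
by rewrite pp ?qq //; have := ltn_ord j; lia.
Qed.

Lemma eq_upto_prod (I : Type) (r : seq I) (Q : pred I) (F G : I -> {poly R}) :
  (forall i, Q i -> eq_upto (F i) (G i)) ->
  eq_upto (\prod_(i <- r | Q i) F i) (\prod_(i <- r | Q i) G i).
Proof.
by move=> FG; apply: big_ind2 => // p q p' q'; apply: eq_uptoM.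
Qed.

Lemma eq_upto_prod1 (I : Type) (r : seq I) (Q : pred I) (F : I -> {poly R}) :
  (forall i, Q i -> eq_upto (F i) 1) -> eq_upto (\prod_(i <- r | Q i) F i) 1.
Proof. by move/(eq_upto_prod r); rewrite [X in eq_upto _ X]big1_eq. Qed.

Lemma eq_upto_sub1Xn k : (n < k)%N -> eq_upto (1 - 'X^k) 1.
Proof.
move=> lt_nk i le_in; rewrite coefB coefXn.
by rewrite (_ : (i == k) = false) ?subr0 //; lia.
Qed.

(** Strong induction on the degree [i]: as [p] has constant term 1, coefficient [i] of [p * q] is
    that of [q] plus a sum involving only earlier coefficients of [q], and likewise for [r]. *)
Lemma eq_upto_cancel p q r :
  p`_0 = 1 -> eq_upto (p * q) (p * r) -> eq_upto q r.
Proof.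
move=> p0 pqr; elim/ltn_ind=> i IHi le_in.
have := pqr i le_in; rewrite !coefM !big_ord_recl /= subn0 p0 !mul1r.
rewrite [X in _ + X = _](eq_bigr (fun j : 'I_i => p`_(bump 0 j) * r`_(i - bump 0 j))).
  by move/addIr.
by move=> j _; have := ltn_ord j; rewrite /bump /= => ji; rewrite IHi //; lia.
Qed.

End TruncatedCongruence.

(** * Partitions with bounded multiplicities *)

Lemma count_flatten_nseq (n : nat) (f : 'I_n -> nat) (x : 'I_n) :
  count_mem (x : nat) (flatten [seq nseq (f y) (y : nat) | y <- enum 'I_n]) = f x.
Proof.
rewrite count_flatten sumnE 2!big_map big_enum /= (bigD1 x) //= big1.
  by rewrite count_nseq /= eqxx mul1n addn0.
by move=> y yx; rewrite count_nseq /= (_ : (_ == _) = false) //; apply/negbTE.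
Qed.

Lemma sumn_count_ord (n : nat) (p : seq nat) :
  all (fun x => x < n)%N p -> sumn p = (\sum_(x < n) x * count_mem (x : nat) p)%N.
Proof.
elim: p => [|y p IHp] /=; first by rewrite big1 // => x _; rewrite muln0.
case/andP=> lt_yn /IHp->.
under [RHS]eq_bigr => x _ do rewrite mulnDr.
rewrite big_split /=; congr (_ + _)%N.
rewrite (bigD1 (Ordinal lt_yn)) //= eqxx muln1 big1 ?addn0 //.
by move=> x; rewrite -val_eqE eq_sym /= => /negbTE->; rewrite muln0.
Qed.

Lemma partition_parts_lt (n : nat) (p : seq nat) :
  is_partition n p -> all (fun x => x < n.+1)%N p.
Proof.
by case/is_partition_bseq=> q <-; apply/allP=> _ /mapP[x _ ->]; apply: ltn_ord.
Qed.

Lemma count_partition_le (n : nat) (p : seq nat) (x : nat) :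
  is_partition n p -> (count_mem x p <= n)%N.
Proof.
case/is_partition_bseq=> q <-; apply: leq_trans (count_size _ _) _.
by rewrite size_map size_bseq.
Qed.

(** A non-increasing list is determined by its multiset of entries, and entries above [n] occur in
    neither list. *)
Lemma eq_partition_count (n : nat) (p q : seq nat) :
  is_partition n p -> is_partition n q ->
  (forall x : 'I_n.+1, count_mem (x : nat) p = count_mem (x : nat) q) -> p = q.
Proof.
move=> pP qP eq_pq.
have geq_trans : transitive geq by move=> y x z /= h1 h2; lia.
have geq_anti : antisymmetric geq by move=> x y /=; lia.
case/and3P: (pP) => sp _ _; case/and3P: (qP) => sq _ _.
apply: (sorted_eq geq_trans geq_anti sp sq); apply/allP=> x _ /=; apply/eqP.
case: (ltnP x n.+1) => [lt_xn|le_nx]; first exact: (eq_pq (Ordinal lt_xn)).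
have notin r : is_partition n r -> count_mem x r = 0%N.
  move=> /partition_parts_lt/allP r_lt; apply/count_memPn/negP=> /r_lt; lia.
by rewrite !notin.
Qed.

(** Partitions correspond to their multiplicity functions; the inverse map sorts the concatenation
    of [f x] copies of each [x]. The bound is strict, so [K x = 1] forbids the part [x]. *)
Lemma num_partitions_mult (n : nat) (P : pred (seq nat)) (K : nat -> nat) :
  K 0%N = 1%N ->
  (forall p, is_partition n p ->
     P p = [forall x : 'I_n.+1, count_mem (x : nat) p < K x]%N) ->
  num_partitions n P =
    #|[set f : {ffun 'I_n.+1 -> 'I_n.+1} |
        (\sum_(x < n.+1) x * f x == n)%N && [forall x : 'I_n.+1, f x < K x]%N]|.
Proof.
move=> K0 PE; rewrite /num_partitions.
pose mult (p : n.-bseq 'I_n.+1) : {ffun 'I_n.+1 -> 'I_n.+1} :=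
  [ffun x : 'I_n.+1 => inord (count_mem (x : nat) (map val p))].
have multE (p : n.-bseq 'I_n.+1) (x : 'I_n.+1) : is_partition n (map val p) ->
    mult p x = count_mem (x : nat) (map val p) :> nat.
  by move=> pP; rewrite ffunE inordK // ltnS count_partition_le.
rewrite -(@card_in_imset _ _ mult).
  apply: eq_card => f; rewrite inE; apply/imsetP/andP.
    case=> p; rewrite inE => /andP[pP Pp] ->; split.
      under eq_bigr => x _ do rewrite multE //.
      rewrite -sumn_count_ord; first by case/and3P: pP.
      exact: partition_parts_lt.
    by move: Pp; rewrite PE // => /forallP pK; apply/forallP=> x; rewrite multE.
  case=> /eqP sum_f /forallP fK.
  pose w := flatten [seq nseq (f y) (y : nat) | y <- enum 'I_n.+1].
  have w_lt : all (fun x => x < n.+1)%N w.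
    by apply/allP=> x /flattenP[_ /mapP[y _ ->]] /nseqP[-> _].
  have countE (x : 'I_n.+1) : count_mem (x : nat) (sort geq w) = f x.
    by rewrite count_sort count_flatten_nseq.
  have wP : is_partition n (sort geq w).
    apply/and3P; split.
    - by apply: sort_sorted => x y /=; lia.
    (* The value [K 0 = 1] forces [f 0 = 0], so all parts are positive. *)
    - rewrite all_sort; apply/allP=> x xw; rewrite lt0n; apply: contraL xw => /eqP->.
      apply/count_memPn; rewrite -(count_sort geq) (countE ord0).
      by apply/eqP; have := fK ord0; rewrite K0 ltnS leqn0.
    - rewrite (sumn_count_ord (n := n.+1)) ?all_sort //; apply/eqP.
      by rewrite -[RHS]sum_f; apply: eq_bigr => x _; rewrite countE.
  have [q qw] := is_partition_bseq wP; exists q.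
    by rewrite inE qw wP PE //; apply/forallP=> x; rewrite countE.
  by apply/ffunP=> x; apply/val_inj; rewrite /= multE qw ?countE.
move=> p q; rewrite !inE => /andP[pP _] /andP[qP _] eq_pq.
apply/val_inj/(inj_map val_inj)/(eq_partition_count pP qP) => x.
by rewrite -!multE // eq_pq.
Qed.

(** Multiplicities above [n] are dropped, since no partition of [n] has them; hence any [k > n]
    encodes an unrestricted part. *)
Definition mult_gf (n x k : nat) : {poly int} :=
  \sum_(j < n.+1 | (j < k)%N) 'X^(x * j).

(** Expanding the product, each choice [f] of multiplicities contributes one monomial, whose
    exponent is the sum of the [x * f x]. *)
Lemma num_partitions_coef (n : nat) (P : pred (seq nat)) (K : nat -> nat) :
  K 0%N = 1%N ->
  (forall p, is_partition n p ->
     P p = [forall x : 'I_n.+1, count_mem (x : nat) p < K x]%N) ->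
  (num_partitions n P)%:R = (\prod_(x < n.+1) mult_gf n x (K x))`_n.
Proof.
move=> K0 PE; rewrite (num_partitions_mult K0 PE) /mult_gf.
rewrite (bigA_distr_big_dep (fun (x j : 'I_n.+1) => j < K x)%N) /=.
rewrite coef_sum -sum1_card natr_sum [LHS]big_mkcond [RHS]big_mkcond /=.
apply: eq_bigr => f _; rewrite inE prodrXr coefXn eq_sym [in RHS]fun_if.
rewrite (_ : (f \in _) = [forall x : 'I_n.+1, f x < K x]%N); last by apply: eq_forallb.
by rewrite andbC; case: [forall x, _]; case: eqP.
Qed.

Lemma mult_gf1 n x : mult_gf n x 1 = 1.
Proof.
rewrite /mult_gf (bigD1 ord0) //= muln0 expr0 big1 ?addr0 // => j.
by rewrite -val_eqE /=; lia.
Qed.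

Lemma mult_gf_geometric n x k :
  (0 < x)%N -> eq_upto n ((1 - 'X^x) * mult_gf n x k) (1 - 'X^(x * k)).
Proof.
move=> x_gt0.
have geom m : (1 - 'X^x) * (\sum_(j < m) 'X^(x * j)) = 1 - 'X^(x * m) :> {poly int}.
  under eq_bigr => j _ do rewrite exprM.
  by rewrite exprM -[RHS]opprB subrX1 -mulNr opprB.
rewrite /mult_gf; case: (leqP k n.+1) => [le_kn | lt_nk].
  by rewrite (big_ord_narrow le_kn) geom.
(* For [k > n.+1] the sum telescopes to [1 - 'X^(x * n.+1)]; this and [1 - 'X^(x * k)] are both 1 up
   to degree [n], because [x > 0]. *)
rewrite (eq_bigl xpredT) => [|j]; last by have := ltn_ord j; lia.
rewrite geom; apply: (@eq_upto_trans _ _ _ 1).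
  by apply: eq_upto_sub1Xn; nia.
by apply/eq_upto_sym/eq_upto_sub1Xn; nia.
Qed.

(** * Euler pairs *)

Lemma prod_sub1X_coef0 (n : nat) (a : pred nat) :
  (\prod_(x < n | ((0 < x) && a x)%N) (1 - 'X^x) : {poly int})`_0 = 1.
Proof.
rewrite -horner_coef0 horner_prod big1 // => x /andP[x_gt0 _].
by rewrite !hornerE expr0n (_ : (_ == _) = false) ?subr0 //; lia.
Qed.

(** Substitute [y = x * t]; the factors with [x * t > n] are 1 up to degree [n]. *)
Lemma prod_sub1X_dilate (n t : nat) (a : pred nat) : (0 < t)%N ->
  eq_upto n
    (\prod_(x < n.+1 | ((0 < x) && a x)%N) (1 - 'X^(x * t)) : {poly int})
    (\prod_(y < n.+1 | ((0 < y) && ((t %| y) && a (y %/ t)))%N) (1 - 'X^y)).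
Proof.
move=> t_gt0; rewrite (bigID (fun x : 'I_n.+1 => x * t <= n)%N) /=.
rewrite -[X in eq_upto _ _ X]mulr1; apply: eq_uptoM; last first.
  by apply: eq_upto_prod1 => x /andP[_ nle]; apply: eq_upto_sub1Xn; lia.
rewrite [X in eq_upto _ _ X](reindex_onto (fun x : 'I_n.+1 => inord (x * t) : 'I_n.+1)
  (fun y : 'I_n.+1 => inord (y %/ t) : 'I_n.+1)) /=; last first.
  move=> y /andP[_ /andP[t_y _]]; apply/val_inj => /=.
  have le_yt : (y %/ t < n.+1)%N by apply: leq_ltn_trans (leq_div _ _) (ltn_ord y).
  by rewrite inordK inordK // ?divnK.
(* When [x * t > n], [inord] returns a default value [y <= n]. The right-hand condition still fails:
   [t %| y] and [y %/ t = x] would give [y = x * t > n]. *)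
have eqP : (fun x : 'I_n.+1 => (0 < x) && a x && (x * t <= n))%N =1
  (fun x : 'I_n.+1 => [&& 0 < (inord (x * t) : 'I_n.+1),
     t %| (inord (x * t) : 'I_n.+1) & a ((inord (x * t) : 'I_n.+1) %/ t)] &&
     (inord ((inord (x * t) : 'I_n.+1) %/ t) == x))%N.
  move=> x; case: (leqP (x * t) n) => [le_xn | lt_nx].
    rewrite inordK ?ltnS // mulnK // inord_val eqxx dvdn_mull // muln_gt0 t_gt0.
    by rewrite !andbT.
  rewrite andbF; apply/esym/negbTE/negP=> /andP[/and3P[_ t_y _] /eqP/(congr1 val)].
  move: (inord _ : 'I_n.+1) t_y => y t_y /=.
  rewrite inordK; last exact: leq_ltn_trans (leq_div _ _) (ltn_ord y).
  by move=> yx; move: lt_nx; rewrite -yx divnK //; have := ltn_ord y; lia.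
rewrite (eq_bigl _ _ eqP); apply: eq_upto_prod => x; rewrite -eqP => /andP[_ le_xn].
by rewrite inordK.
Qed.

Lemma num_partitions_euler_pair (a : pred nat) (t n : nat) :
  (0 < t)%N -> (forall x, a x -> a (t * x)%N) ->
  num_partitions n (fun p => all a p && all (fun x => count_mem x p < t)%N p) =
  num_partitions n
    (fun p => all a p && all (fun x => ~~ ((t %| x) && a (x %/ t)))%N p).
Proof.
(* With A the set of positive integers satisfying [a], the predicate [b] describes tA on positive
   integers, and [a_mul] puts tA inside A. *)
move=> t_gt0 a_mul; pose b x := ((t %| x) && a (x %/ t))%N.
have b_a x : b x -> a x by case/andP=> t_x /a_mul; rewrite mulnC divnK.
(* Strict multiplicity bounds for the two sides: 1 excludes a part, and [n.+1] leaves it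
   unrestricted. *)
pose K x := (if (0 < x) && a x then t else 1)%N.
pose L x := (if (0 < x) && a x && ~~ b x then n.+1 else 1)%N.
apply/eqP; rewrite -(eqr_nat int); apply/eqP.
rewrite (num_partitions_coef (K := K)) //; last first.
  move=> p pP; have p_lt := allP (partition_parts_lt pP).
  case/and3P: pP => _ /allP p_gt0 _; rewrite -all_predI; apply/allP/forallP.
    move=> pa x; rewrite /K; have [xp|xp] := boolP ((x : nat) \in p).
      by have /andP[/= -> cnt_x] := pa _ xp; rewrite p_gt0.
    by rewrite (count_memPn xp); case: ifP.
  move=> pK x xp; have := pK (Ordinal (p_lt _ xp)); rewrite /K /= p_gt0 //=.
  by case: (a x) => //=; rewrite ltnS leqNgt -has_count has_pred1 xp.
rewrite (num_partitions_coef (K := L)) //; last first.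
  move=> p pP; have p_lt := allP (partition_parts_lt pP).
  have p_cnt x := count_partition_le x pP.
  case/and3P: pP => _ /allP p_gt0 _; rewrite -all_predI; apply/allP/forallP.
    move=> pa x; rewrite /L; have [xp|xp] := boolP ((x : nat) \in p).
      by have /andP[/= -> ->] := pa _ xp; rewrite p_gt0 //= ltnS p_cnt.
    by rewrite (count_memPn xp); case: ifP.
  move=> pL x xp; have := pL (Ordinal (p_lt _ xp)); rewrite /L /= p_gt0 //=.
  by rewrite -/(b x); case: (a x && ~~ b x) => //=; rewrite ltnS leqNgt -has_count has_pred1 xp.
pose D : {poly int} := \prod_(x < n.+1 | ((0 < x) && a x)%N) (1 - 'X^x).
suff /(_ n (leqnn n)) : eq_upto n (\prod_(x < n.+1) mult_gf n x (K x))
    (\prod_(x < n.+1) mult_gf n x (L x)) by [].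
apply: (@eq_upto_cancel _ _ D); first exact: prod_sub1X_coef0.
apply: (@eq_upto_trans _ _ _
  (\prod_(x < n.+1 | ((0 < x) && a x)%N) (1 - 'X^(x * t)))).
  (* First side: parts outside A contribute 1, and each part in A pairs with its factor of [D]. *)
  rewrite [X in D * X](bigID (fun x : 'I_n.+1 => (0 < x) && a x)%N) /=.
  rewrite [X in _ * (_ * X)]big1 ?mulr1 => [|x /negbTE xa]; last first.
    by rewrite /K xa mult_gf1.
  rewrite /D -big_split /=; apply: eq_upto_prod => x xa.
  by rewrite /K xa; apply: mult_gf_geometric; case/andP: xa.
apply: eq_upto_trans (@prod_sub1X_dilate n t a t_gt0) _.
have -> : \prod_(x < n.+1) mult_gf n x (L x) =
    \prod_(x < n.+1 | ((0 < x) && a x && ~~ b x)%N) mult_gf n x n.+1.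
  rewrite [RHS]big_mkcond; apply: eq_bigr => x _; rewrite /L.
  by case: ifP => // _; rewrite mult_gf1.
(* Second side: split [D] into tA and its complement in A. Over the complement the factors cancel
   the geometric sums up to degree [n], leaving the product over tA. *)
rewrite [D](bigID (fun x : 'I_n.+1 => b x)) /= -mulrA -big_split /=.
apply: eq_upto_sym; rewrite -[X in eq_upto _ _ X]mulr1; apply: eq_uptoM.
  rewrite (eq_bigl (fun x : 'I_n.+1 => (0 < x) && b x)%N) // => x.
  by have := b_a x; case: (b x) => [->|] //; rewrite ?andbT ?andbF.
apply: eq_upto_prod1 => x /andP[/andP[x_gt0 _] _].
apply: eq_upto_trans (@mult_gf_geometric n _ _ x_gt0) _.
by apply: eq_upto_sub1Xn; nia.
Qed.

(** * The residue conditions in terms of parity and divisibility *)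

Lemma avoids_evenE (s m : nat) : (0 < s)%N -> ~~ odd s ->
  avoids_even s m = odd m || (s %| m)%N.
Proof.
move=> s_gt0 s_even; have sE : s = (2 * s./2)%N by lia.
(* Reduction modulo the even number [s] preserves parity, so the excluded residues are exactly the
   nonzero even ones. *)
have odd_mod : odd (m %% s) = odd m.
  by rewrite [in RHS](divn_eq m s) oddD oddM (negbTE s_even) andbF.
have lt_ms := ltn_pmod m s_gt0.
apply/allP/orP.
  move=> av; have [|m_even] := boolP (odd m); [by left | right].
  apply: contraT; rewrite /dvdn => m_s.
  have /av : (m %% s)./2 \in iota 1 (s./2 - 1) by rewrite mem_iota; lia.
  by rewrite (_ : (2 * (m %% s)./2)%N = m %% s)%N ?modn_mod ?eqxx //; lia.
move=> m_ok j; rewrite mem_iota => j_lt; rewrite (@modn_small (2 * j)); last by lia.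
apply/eqP => mj; move: m_ok; rewrite -odd_mod /dvdn mj; lia.
Qed.

Lemma avoids_t_multiplesE (s t m : nat) : (0 < s)%N -> ~~ odd s -> (0 < t)%N ->
  avoids_t_multiples s t m = ~~ ((t %| m) && avoids_even s (m %/ t))%N.
Proof.
move=> s_gt0 s_even t_gt0; rewrite avoids_evenE // /avoids_t_multiples mod0n.
have [t_m|t_m] /= := boolP (t %| m)%N; last first.
  (* All excluded classes modulo [t * s] consist of multiples of [t]. *)
  have neq k : (m == t * k %[mod t * s])%N = false.
    apply/negP=> /eqP/(congr1 (modn^~ t)).
    by rewrite !modn_dvdm ?dvdn_mulr // modnMr => /eqP; apply/negP.
  have := neq 0%N; rewrite muln0 mod0n => ->.
  by apply/allP=> r _; rewrite neq.
have {t_m}-> : m = (t * (m %/ t))%N by rewrite mulnC divnK.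
rewrite mulKn //; move: (m %/ t)%N => {}m.
(* For a multiple of [t], dividing by [t] turns the excluded classes into 0 and the odd residues
   modulo [s]. *)
have eq_mod k l : (t * k == t * l %[mod t * s])%N = (k == l %[mod s])%N.
  by rewrite -!muln_modr eqn_pmul2l.
rewrite -muln_modr muln_eq0 (gtn_eqF t_gt0) /= negb_or andbC -/(dvdn s m).
congr (_ && _); have odd_mod : odd (m %% s) = odd m.
  by rewrite [in RHS](divn_eq m s) oddD oddM (negbTE s_even) andbF.
have lt_ms := ltn_pmod m s_gt0.
apply/allP/idP => [av | m_even r].
  apply/negP => m_odd.
  have /av : (m %% s)./2 \in iota 0 s./2 by rewrite mem_iota; lia.
  rewrite muln_modr eq_mod.
  by rewrite (_ : (2 * (m %% s)./2 + 1)%N = m %% s)%N ?modn_mod ?eqxx //; lia.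
rewrite mem_iota => r_lt; rewrite muln_modr eq_mod (@modn_small (2 * r + 1)); last by lia.
by apply/eqP => mr; move: m_even; rewrite -odd_mod mr; lia.
Qed.

Local Close Scope ring_scope.

Theorem theorem15 (s t : nat) (hs : 4 <= s) (hs_even : ~~ odd s)
    (ht : 3 <= t) (hts : avoids_even s t) (n : nat) :
  C s t n = E s t n.
Proof.
have s_gt0 : 0 < s by lia.
have t_gt0 : 0 < t by lia.
rewrite /C num_partitions_euler_pair //.
  apply: eq_card => p; rewrite !inE; congr (_ && (_ && _)).
  by apply: eq_all => x; rewrite avoids_t_multiplesE.
(* Being odd or divisible by [s] is preserved by products, so the hypothesis on [t] gives closure
   under multiplication by [t]. *)
move=> x; move: hts; rewrite !avoids_evenE // oddM.
case/orP=> [-> /orP[->|s_x] | s_t _] //; apply/orP; right.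
  exact: dvdn_mull.
exact: dvdn_mulr.
Qed.
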